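(* Let $X$ be a complete metric space, $\Gamma$ a group of homeomorphisms of $X$, and $Y\subseteq X$ a $\Gamma$-invariant set. Let $\mathcal{U}$ be the family of open sets $U\subseteq X$ for which there is no finite set $\Delta\subseteq\Gamma$ such that $Y\subseteq\Delta\cdot U$. Let $\langle R_n\mid n\in\mathbb{N}\rangle$ be an increasing sequence of reflexive symmetric closed subsets of $X\times X$. Suppose there is a compact $\mathcal{I}_{\mathcal{U}}$-positive set $K\subseteq X$ such that: (a) for all $n\in\mathbb{N}$ and all $x\in K$ there is $\gamma\in\Gamma$ such that $(x,\gamma\cdot x)\notin R_n^{(4)}$; (b) for all $\gamma\in\Gamma$ there is $n\in\mathbb{N}$ such that for all $x\in\Gamma\cdot K$, $(x,\gamma\cdot x)\in R_n$. Then for some $x\in K$ there is a continuous injective map $\phi:2^{\omega}\to\overline{\Gamma\cdot x}$ which is a homomorphism from the pair $(\mathbb{E}_0,{\sim}\mathbb{E}_0)$ to the pair $(E_\Gamma^X,{\sim}\bigcup_{n\in\mathbb{N}}R_n)$; that is, for all $c,d\in 2^\omega$: if $c\mathrel{\mathbb{E}_0}d$ then $\phi(c)\mathrel{E_\Gamma^X}\phi(d)$, and if $\neg(c\mathrel{\mathbb{E}_0}d)$ then $(\phi(c),\phi(d))\notin\bigcup_{n\in\mathbb{N}}R_n$.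
   Context: For a family $\mathcal{U}$ of open subsets of a topological space $X$, $\mathcal{I}_{\mathcal{U}}$ is the family of sets $F\subseteq X$ such that for every $U\in\mathcal{U}$ there is an open $V\supseteq F$ with $V\cup U\in\mathcal{U}$. A set $F\subseteq X$ is $\mathcal{I}_{\mathcal{U}}$-positive if $F\notin\mathcal{I}_{\mathcal{U}}$. $\Delta\cdot U=\bigcup_{\delta\in\Delta}\delta\cdot U$ (similarly $\Gamma\cdot K$, $\Gamma\cdot x$). $\overline{Z}$ is topological closure and ${\sim}Z$ is complement. $R^{(k)}$ is the $k$-fold composition of the relation $R$ with itself: $x\mathrel{R^{(k)}}y$ iff there are $x=z_0,z_1,\dots,z_k=y$ in $X$ with $z_i\mathrel{R}z_{i+1}$ for $i<k$. $\mathbb{E}_0$ is the equivalence relation on $2^\omega$ of eventual equality: $c\mathrel{\mathbb{E}_0}d$ iff there is $n$ with $c(m)=d(m)$ for all $m>n$. $E_\Gamma^X$ is the orbit equivalence relation of $\Gamma$ on $X$. *)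

(* Defs.v *)
From HB Require Import structures.
From mathcomp Require Import all_boot all_order all_algebra.
From mathcomp Require Import all_classical all_reals all_analysis.

Set Implicit Arguments.
Unset Strict Implicit.
Unset Printing Implicit Defensive.

Local Open Scope classical_set_scope.

#[short(type="completeMetricType")]
HB.structure Definition CompleteMetric (R : numFieldType) :=
  {T of Metric R T & Complete T}.

Definition ideal_of (X : topologicalType) (Us : set (set X)) : set (set X) :=
  [set F | forall U, Us U -> exists V, [/\ open V, F `<=` V & Us (V `|` U)]].

Definition ideal_positive (X : topologicalType) (Us : set (set X)) (F : set X) :=
  ~ ideal_of Us F.

Definition homeomorphism (X : topologicalType) (f : X -> X) :=
  continuous f /\
  exists g : X -> X, [/\ continuous g, cancel f g & cancel g f].

Definition homeomorphism_group (X : topologicalType) (G : set (X -> X)) :=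
  [/\ forall g, G g -> homeomorphism g,
      G id,
      forall g h, G g -> G h -> G (g \o h) &
      forall g, G g -> exists h, [/\ G h, cancel g h & cancel h g]].

Definition translates (X : Type) (D : set (X -> X)) (U : set X) : set X :=
  \bigcup_(d in D) (d @` U).

Definition orbit_of (X : Type) (G : set (X -> X)) (x : X) : set X :=
  [set g x | g in G].

Definition invariant_set (X : Type) (G : set (X -> X)) (Y : set X) :=
  forall g, G g -> g @` Y `<=` Y.

Definition noncovering_open (X : topologicalType) (G : set (X -> X))
    (Y : set X) : set (set X) :=
  [set U | open U /\
    ~ exists D : set (X -> X),
        [/\ finite_set D, D `<=` G & Y `<=` translates D U]].

Definition reflexive_rel (X : Type) (R : set (X * X)) := forall x, R (x, x).

Definition symmetric_rel (X : Type) (R : set (X * X)) :=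
  forall x y, R (x, y) -> R (y, x).

Definition rel_power (X : Type) (R : set (X * X)) (k : nat) : set (X * X) :=
  [set xy | exists z : nat -> X,
    [/\ z 0 = xy.1, z k = xy.2 & forall i, i < k -> R (z i, z i.+1)]].

Definition E0 : set (cantor_space * cantor_space) :=
  [set cd | exists n : nat, forall m : nat, n < m -> cd.1 m = cd.2 m].

Definition orbit_eq (X : Type) (G : set (X -> X)) : set (X * X) :=
  [set xy | orbit_of G xy.1 xy.2].

Definition rel_hom (S T : Type) (A : set (S * S)) (B : set (T * T))
    (f : S -> T) :=
  forall c d, A (c, d) -> B (f c, f d).

Definition rel_pair_hom (S T : Type) (A : set (S * S) * set (S * S))
    (B : set (T * T) * set (T * T)) (f : S -> T) :=
  rel_hom A.1 B.1 f /\ rel_hom A.2 B.2 f.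

(* Main.v *)
(* Build elements g_0, g_1, ... of G and shrinking open sets O_n such that
   phi(c), the unique point of the intersection of the sets
   g_0^(c_0) ... g_(n-1)^(c_(n-1)) O_n, is well defined. Sequences differing in
   one position n then go to points outside R_n, and E0-equivalent sequences to
   points of one orbit. Keeping in each O_n a positive compact subset of K puts
   x := phi(0) in K.
   To find g = g_n, choose U witnessing that the current compact set C is
   positive, and an open V containing C; then finitely many translates d(V u U),
   d in D, cover Y. A point x of C that is locally positive relative to U
   returns, after any g0 in G, to the closure of some d V. The finite set D is
   known before g0 is chosen, so g0 can be taken to move x outside R_m^(4) with
   m bounding the displacement of D and of the words built so far. Then
   g = d^-1 g0 returns x near C, and h x, k g x are not R_n-related for any of
   these words h, k. *)

Require Import Defs.
From mathcomp Require Import all_boot all_order all_algebra.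
From mathcomp Require Import all_classical all_reals all_analysis.

Import Order.TTheory GRing.Theory Num.Theory.

Local Open Scope classical_set_scope.

(** * Positivity relative to a fixed [U], and locally positive points *)

(* The sets [F] satisfying the condition for [U' = U] alone need not be closed
   under unions; quantifying over all [U'] containing [U] repairs this, while
   [U] still witnesses positivity. *)
Definition relative_ideal {X : topologicalType} (Us : set (set X)) (U : set X) :
    set (set X) :=
  [set F | forall U', Us U' -> U `<=` U' ->
     exists V, [/\ open V, F `<=` V & Us (V `|` U')]].

Section RelativeIdeal.
Context {X : topologicalType} (Us : set (set X)).

Lemma ideal_of_relative U : ideal_of Us `<=` relative_ideal Us U.
Proof. by move=> F IF U' UsU' _; exact: IF. Qed.

(** Taking [U' = U] makes [U] witness relative positivity; the last conclusion later yields a finite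
    cover of [Y]. *)
Lemma ideal_positive_relative F : ideal_positive Us F ->
  exists2 U, Us U & ~ relative_ideal Us U F /\
    forall V, open V -> F `<=` V -> ~ Us (V `|` U).
Proof.
move=> /existsNP[U] /not_implyP[UsU noV].
have bigV V : open V -> F `<=` V -> ~ Us (V `|` U).
  by move=> oV FV UsV; apply: noV; exists V.
exists U => //; split=> // IF.
have [V [oV FV]] := IF U UsU (@subset_refl _ _).
exact: bigV.
Qed.

Lemma relative_ideal0 U : relative_ideal Us U set0.
Proof.
move=> U' UsU' _; exists set0; rewrite set0U; split => //; exact: open0.
Qed.

Lemma relative_idealS U E F :
  E `<=` F -> relative_ideal Us U F -> relative_ideal Us U E.
Proof.
move=> EF IF U' UsU' UU'; have [V [oV FV UsV]] := IF _ UsU' UU'.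
by exists V; split => //; exact: subset_trans FV.
Qed.

Lemma relative_idealU U E F :
  relative_ideal Us U E -> relative_ideal Us U F ->
  relative_ideal Us U (E `|` F).
Proof.
move=> IE IF U' UsU' UU'; have [V [oV EV UsV]] := IE _ UsU' UU'.
have [W [oW FW UsW]] := IF _ UsV (subset_trans UU' (@subsetUr _ _ _)).
exists (V `|` W); split; [exact: openU|exact: setUSS|].
by rewrite [V `|` W]setUC -setUA.
Qed.

Lemma compact_locally_positive (U K : set X) :
  compact K -> ~ relative_ideal Us U K ->
  exists2 x, K x & forall W, nbhs x W -> ~ relative_ideal Us U (K `&` W).
Proof.
(* A cluster point in [K] of the filter dual to the relative ideal. *)
move=> cK nK; pose F := [set A | relative_ideal Us U (K `\` A)].
have PF : ProperFilter F.
  apply: Build_ProperFilter; first by rewrite /F /= setD0.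
  split.
  - by rewrite /F /= setDT; exact: relative_ideal0.
  - by move=> A B FA FB; rewrite /F /= setDIr; exact: relative_idealU.
  - by move=> A B AB; apply: relative_idealS; exact: setDS.
have FK : F K by rewrite /F /= setDv; exact: relative_ideal0.
have [x [Kx clx]] := cK F PF FK.
exists x => // W Wx IW.
have FW : F (~` W) by rewrite /F /= setDE setCK.
by have [y [nWy Wy]] := clx _ _ FW Wx.
Qed.

End RelativeIdeal.

(** * Recurrence of locally positive points under the group *)

Section GroupAction.
Context {X : topologicalType} {G : set (X -> X)} {Y : set X}.
Hypothesis hG : homeomorphism_group G.
Hypothesis hY : invariant_set G Y.

Lemma group_continuous {g} : G g -> continuous g.
Proof. by move=> Gg; have [h _ _ _] := hG; have [] := h _ Gg. Qed.

Lemma group_comp {g h} : G g -> G h -> G (g \o h).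
Proof. by have [_ _ h3 _] := hG; exact: h3. Qed.

Lemma group_inv {g} : G g -> exists h, [/\ G h, cancel g h & cancel h g].
Proof. by have [_ _ _] := hG; apply. Qed.

Lemma group_image_closed g (Z : set X) : G g -> closed Z -> closed (g @` Z).
Proof.
move=> Gg cZ; have [h [Gh gh hg]] := group_inv Gg.
have -> : g @` Z = h @^-1` Z.
  apply/seteqP; split=> [_ [z Zz <-]|z /= Zhz]; first by rewrite /= gh.
  by exists (h z).
by apply: closed_comp => // x _; exact: group_continuous.
Qed.

(* If [g x] stayed away from the finitely many translates of [closure V], then
   so would [g @` W] for a neighbourhood [W] of [x]; as [Y] is covered by the
   translates of [V] and [U], finitely many translates of [U] would then cover
   [W `&` Y], so that [W] would be redundant over every [U'] containing [U]. *)
Lemma locally_positive_recurrence {U V K : set X} {D : set (X -> X)} {x g} :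
  finite_set D -> D `<=` G -> Y `<=` translates D (V `|` U) ->
  (forall W, nbhs x W -> ~ relative_ideal (noncovering_open G Y) U (K `&` W)) ->
  G g -> translates D (closure V) (g x).
Proof.
move=> fD DG YD posx Gg; apply: contrapT => ngx.
have cg := group_continuous Gg.
pose W := g @^-1` (~` translates D (closure V)).
have oW : open W.
  apply: open_comp => [y _|]; first exact: cg.
  apply: closed_openC; apply: closed_bigcup => // d /DG Gd.
  by apply: group_image_closed => //; exact: closed_closure.
apply: (posx W); first exact: open_nbhs_nbhs.
move=> U' [oU' ncU'] UU'; exists W; split => //.
split; first exact: openU.
move=> [E [fE EG YE]]; apply: ncU'.
have [g' [Gg' gg' g'g]] := group_inv Gg.
exists (E `|` [set e \o (g' \o d) | e in E & d in D]); split.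
- by rewrite finite_setU; split => //; exact: finite_image2.
- move=> h [/EG//|[e /EG Ge] [d /DG Gd] <-].
  by apply: group_comp => //; exact: group_comp.
- move=> y Yy; have [e Ee [w Ww ew]] := YE _ Yy.
  case: Ww => [Ww|U'w]; last by exists e; [left|exists w].
  have Yw : Y w.
    have [e' [Ge' ee' _]] := group_inv (EG _ Ee).
    by apply: (hY _ Ge'); exists y => //; rewrite -ew ee'.
  have [d Dd [v [Vv|Uv] dv]] : translates D (V `|` U) (g w).
    by apply: YD; apply: (hY _ Gg); exists w.
  + exfalso; apply: Ww; exists d => //; exists v => //.
    exact: subset_closure.
  + exists (e \o (g' \o d)); first by right; exists e => //; exists d.
    by exists v; [exact: UU'|rewrite /= dv gg'].
Qed.

End GroupAction.

(** * Small neighbourhoods, and nested sets in complete spaces *)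

Lemma filter_finite_forall {I : choiceType} {T : Type} {F : set_system T}
    {D : set I} {P : I -> set T} : Filter F -> finite_set D ->
  (forall i, D i -> F (P i)) -> F [set t | forall i, D i -> P i t].
Proof.
move=> FF fD FP.
have := @filter_bigI T I (fset_set D) P F FF; rewrite fset_setK//; apply.
by move=> i; rewrite in_fset_set// inE; exact: FP.
Qed.

Lemma nbhs_open_closure {X : uniformType} {x : X} {N : set X} : nbhs x N ->
  exists O, [/\ open O, O x & closure O `<=` N].
Proof.
move=> /uniform_regular[B Bx BN]; exists B^°; split => //.
- exact: open_interior.
- by apply: subset_trans BN; apply: closureS; exact: interior_subset.
Qed.

Section SmallBalls.
Context {A : realType}.

Lemma exists_natSinv_lt {e : A} : (0 < e)%R -> exists n, (n.+1%:R^-1 < e)%R.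
Proof.
move=> e0; have [N _ /(_ N (leqnn N)) NE] := near_infty_natSinv_lt (PosNum e0).
by exists N.
Qed.

Lemma eq_small_balls {X : metricType A} {x y : X} N :
  (forall n, (N <= n)%N -> ball x n.+1%:R^-1%R y) -> x = y.
Proof.
move=> xy; apply/eqP/negPn; rewrite -(mdist_gt0 x y); apply/negP => xy0.
have [n nxy] := exists_natSinv_lt xy0.
have := xy _ (leq_maxl N n); rewrite ballEmdist /= => mxy.
have := lt_trans nxy mxy; apply/negP; rewrite -leNgt lef_pV2 ?posrE//.
by rewrite ler_nat ltnS leq_maxr.
Qed.

(** Cantor's intersection theorem: any choice of points [u n] is Cauchy, and its limit lies in the
    closure of each [W n.+1], hence in [W n]. *)
Lemma nested_sets_meet {X : completeMetricType A} (W : nat -> set X) :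
  (forall n, W n !=set0) -> (forall n, closure (W n.+1) `<=` W n) ->
  (forall n x y, W n.+1 x -> W n.+1 y -> ball x n.+1%:R^-1%R y) ->
  exists x, forall n, W n x.
Proof.
move=> /choice[u Wu] WS diamW.
have decW m n : (m <= n)%N -> W n `<=` W m.
  move=> /subnKC <-; elim: (n - m)%N => [|k IH]; first by rewrite addn0.
  by rewrite addnS => x Wx; apply: IH; apply: WS; exact: subset_closure.
have cvu : cvg (u @ \oo).
  apply: cauchy_cvg; apply: cauchy_exP => e e0.
  have [N Ne] := exists_natSinv_lt e0.
  exists (u N.+1); exists N.+1 => // k /= Nk.
  by apply: (le_ball (ltW Ne)); apply: diamW => //; exact: decW (Wu k).
exists (lim (u @ \oo)) => n; apply: WS.
apply: (@closed_cvg _ _ \oo _ u) cvu; first exact: closed_closure.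
by exists n.+1 => // k /= nk; apply: subset_closure; exact: decW (Wu k).
Qed.

End SmallBalls.

(** * Binary sequences and words in group elements *)

Lemma nbhs_cantor_prefix (c : cantor_space) n :
  nbhs c [set d : cantor_space | forall i, (i < n)%N -> d i = c i].
Proof.
apply: (@filter_finite_forall nat cantor_space (nbhs c) [set i | (i < n)%N]).
  exact: finite_II.
move=> i _; apply: (@proj_continuous nat (fun=> bool) i c [set c i]).
by apply: discrete_set1.
Qed.

(* [word g c n] is g_0^(c_0) o ... o g_(n-1)^(c_(n-1)). *)
Fixpoint word {X : Type} (g : nat -> X -> X) (c : nat -> bool) n : X -> X :=
  if n is m.+1 then word g c m \o (if c m then g m else id) else id.

Lemma eq_word {X : Type} (g : nat -> X -> X) (c d : nat -> bool) n :
  (forall i, (i < n)%N -> c i = d i) -> word g c n = word g d n.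
Proof.
elim: n => //= n IH cd; rewrite cd// IH// => i ilt.
by apply: cd; exact: ltnW.
Qed.

(** Letters are appended on the right, so a left factor [h] relating the two words survives equal
    further letters. *)
Lemma word_eventually_eq {X : Type} (g : nat -> X -> X)
    (c d : nat -> bool) n h :
  (forall m, (n <= m)%N -> c m = d m) -> word g d n = h \o word g c n ->
  forall m, (n <= m)%N -> word g d m = h \o word g c m.
Proof.
move=> cd hn m /subnKC <-; elim: (m - n)%N => [|k IH]; first by rewrite addn0.
by rewrite addnS /= IH cd// leq_addr.
Qed.

(** * Stages of the construction and their refinement *)

Section Embedding.
Context {A : realType} {X : completeMetricType A} {G : set (X -> X)} {Y : set X}
  {R : nat -> set (X * X)} {K : set X}.
Hypothesis hG : homeomorphism_group G.
Hypothesis hY : invariant_set G Y.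
Hypothesis hRmono : {homo R : m n / (m <= n)%N >-> m `<=` n}.
Hypothesis hRsym : forall n, symmetric_rel (R n).
Hypothesis hRclosed : forall n, closed (R n).
Hypothesis hKcompact : compact K.
Hypothesis hKpos : ideal_positive (noncovering_open G Y) K.
Hypothesis ha : forall (n : nat) (x : X), K x ->
  exists2 g, G g & ~ rel_power (R n) 4 (x, g x).
Hypothesis hb : forall g, G g ->
  exists n : nat, forall x, translates G K x -> R n (x, g x).

Lemma finite_bounded_displacement n (D : set (X -> X)) :
  finite_set D -> D `<=` G ->
  exists2 m, (n <= m)%N &
    forall d, D d -> forall x, translates G K x -> R m (x, d x).
Proof.
move=> fD DG.
pose P d := [set m | forall x, translates G K x -> R m (x, d x)].
have : \forall m \near \oo, (n <= m)%N /\ forall d, D d -> P d m.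
  apply: filterI; first exact: nbhs_infty_ge.
  apply: filter_finite_forall => // d /DG /hb[k hk].
  by exists k => // m km x Kx; apply: (hRmono _ _ km); exact: hk.
by move=> /filter_ex[m [nm hm]]; exists m.
Qed.

(* [maps] is to contain every word of length [n] in the elements chosen so far.
   The closure of [inner] lies in [outer] because recurrence returns a point
   only to the closure of a given neighbourhood of [core]. *)
Record stage := Stage {
  maps : set (X -> X);
  outer : set X;
  inner : set X;
  core : set X }.

Definition valid_stage s :=
  [/\ finite_set (maps s) /\ maps s `<=` G,
      open (outer s),
      open (inner s) /\ closure (inner s) `<=` outer s,
      core s `<=` inner s /\ core s `<=` K &
      compact (core s) /\ ideal_positive (noncovering_open G Y) (core s)].

(** The second and third clauses nest the images of [outer] whichever letter is taken, the fourth
    shrinks them, and the last separates the two choices of letter [n] under any prefixes [h],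
    [k]. *)
Definition refines n (s : stage) (g : X -> X) (s' : stage) :=
  [/\ G g /\ maps s' = maps s `|` [set h \o g | h in maps s],
      closure (outer s') `<=` outer s,
      (forall y, closure (outer s') y -> outer s (g y)),
      (forall h y z, maps s' h -> outer s' y -> outer s' z ->
         ball (h y) n.+1%:R^-1%R (h z)) &
      (forall h k y z, maps s h -> maps s k -> outer s' y -> outer s' z ->
         ~ R n (h y, k (g z)))].

Lemma rel_power4 (Q : set (X * X)) (z0 z1 z2 z3 z4 : X) :
  Q (z0, z1) -> Q (z1, z2) -> Q (z2, z3) -> Q (z3, z4) ->
  rel_power Q 4 (z0, z4).
Proof.
move=> Q0 Q1 Q2 Q3; exists (nth z0 [:: z0; z1; z2; z3; z4]).
by split => // -[|[|[|[|]]]].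
Qed.

Lemma group_translate (g : X -> X) x : G g -> K x -> translates G K (g x).
Proof. by move=> Gg Kx; exists g => //; exists x. Qed.

(** Positivity near [x] is concluded for the full ideal, not only relative to [U], because each
    stage chooses a new [U]. *)
Lemma separating_recurrence n (S : set (X -> X)) (O V C : set X) :
  finite_set S -> S `<=` G -> open V -> closure V `<=` O ->
  C `<=` V -> C `<=` K -> compact C ->
  ideal_positive (noncovering_open G Y) C ->
  exists x g, [/\ forall W, nbhs x W ->
                    ideal_positive (noncovering_open G Y) (C `&` W),
    C x, G g, O (g x) & forall h k, S h -> S k -> ~ R n (h x, k (g x))].
Proof.
move=> fS SG oV VO CV CK cC posC.
have [U [oU ncU] [posU bigU]] := ideal_positive_relative _ _ posC.
have [D [fD DG YD]] : exists D : set (X -> X),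
    [/\ finite_set D, D `<=` G & Y `<=` translates D (V `|` U)].
  apply: contrapT => nD; apply: (bigU _ oV CV).
  by split => //; exact: openU.
have [x Cx posx] := compact_locally_positive _ _ _ cC posU.
have [m nm hm] := finite_bounded_displacement n (D `|` S)
  ltac:(by rewrite finite_setU) ltac:(by move=> h [/DG|/SG]).
have [g0 Gg0 ng0] := ha m _ (CK _ Cx).
have [d Dd [v Vv dv]] := locally_positive_recurrence hG hY fD DG YD posx Gg0.
have [d' [Gd' dd' d'd]] := group_inv hG (DG _ Dd).
have Gg := group_comp hG Gd' Gg0.
exists x, (d' \o g0); split => //.
- move=> W Wx IW; apply: (posx _ Wx); exact: ideal_of_relative.
- by rewrite /= -dv dd'; exact: VO.
move=> h k Sh Sk Rn; apply: ng0.
have [_ Gid _ _] := hG; have Kx := CK _ Cx.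
(* The path x, h x, k g x, g x, d g x = g0 x, where g = d^-1 g0. *)
apply: (@rel_power4 _ _ (h x) (k (d' (g0 x))) (d' (g0 x))).
- by apply: hm; [right|exact: (group_translate id)].
- exact: (hRmono _ _ nm).
- by apply: hRsym; apply: hm; [right|exact: (group_translate (d' \o g0))].
- rewrite -{2}[g0 x]d'd; apply: hm; first by left.
  exact: (group_translate (d' \o g0)).
Qed.

(** Finitely many requirements, each open at [x], hold on a neighbourhood of [x], in which the new
    stage is chosen. *)
Lemma refinement n s : valid_stage s ->
  exists p : (X -> X) * stage, valid_stage p.2 /\ refines n s p.1 p.2.
Proof.
move=> [[fS SG] oO [oV VO] [CV CK] [cC posC]].
have [x [g [posx Cx Gg Ogx sep]]] :=
  separating_recurrence n _ _ _ _ fS SG oV VO CV CK cC posC.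
set S := maps s in fS SG sep *.
pose S' := S `|` [set h \o g | h in S].
have fS' : finite_set S'.
  by rewrite finite_setU; split => //; exact: finite_image.
have S'G : S' `<=` G.
  by move=> h [/SG//|[k /SG Gk <-]]; exact: group_comp.
have Ox : outer s x by apply: VO; apply: subset_closure; exact: CV.
have cg := group_continuous hG Gg.
have e0 : (0 < n.+1%:R^-1 / 2 :> A)%R by rewrite divr_gt0.
pose P (hk : (X -> X) * (X -> X)) :=
  [set yz : X * X | ~ R n (hk.1 yz.1, hk.2 (g yz.2))].
have nbR : nbhs (x, x) [set yz | forall hk, (S `*` S) hk -> P hk yz].
  apply: filter_finite_forall; first exact: finite_setX.
  move=> [h k] [/= Sh Sk].
  have cF : {for (x, x), continuous (fun yz : X * X => (h yz.1, k (g yz.2)))}.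
    have ckg : continuous (k \o g).
      by apply: (group_continuous hG); apply: group_comp => //; exact: SG.
    apply: cvg_pair.
      exact: (cvg_comp fst h cvg_fst (group_continuous hG (SG _ Sh) x)).
    exact: (cvg_comp snd (k \o g) cvg_snd (ckg x)).
  apply: (cF (~` R n)); apply: open_nbhs_nbhs; split.
    exact: closed_openC.
  exact: sep.
have [[A1 A2] /= [A1x A2x] A12] := nbR.
have nbB : nbhs x
    [set y | forall h, S' h -> ball (h x) (n.+1%:R^-1 / 2)%R (h y)].
  apply: filter_finite_forall => // h /S'G Gh.
  by apply: (group_continuous hG Gh); exact: nbhsx_ballx.
have nbO : nbhs x (outer s) by exact: open_nbhs_nbhs.
have nbg : nbhs x (g @^-1` outer s) by apply: cg; exact: open_nbhs_nbhs.
(* [Q] and [V] become the new [outer] and [inner]; [closure W] cuts the core down to a compact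
   positive set inside [V]. *)
have [Q [oQ Qx QN]] := nbhs_open_closure
  (filterI (filterI A1x A2x) (filterI nbB (filterI nbO nbg))).
have [V [oV' V'x VQ]] := nbhs_open_closure (open_nbhs_nbhs (conj oQ Qx)).
have [W [oW Wx WV]] := nbhs_open_closure (open_nbhs_nbhs (conj oV' V'x)).
exists (g, Stage S' Q V (core s `&` closure W)); split.
  split => //=.
  - by split=> y [Cy Wy]; [exact: WV|exact: CK].
  - split; first by apply: compact_closedI => //; exact: closed_closure.
    apply: posx.
    apply: filterS (open_nbhs_nbhs (conj oW Wx)); exact: subset_closure.
have QQ := @subset_closure _ Q.
split => //=.
- by move=> y /QN[_ [_ [Oy _]]].
- by move=> y /QN[_ [_ [_ Oy]]].
- move=> h y z S'h /QQ/QN[_ [By _]] /QQ/QN[_ [Bz _]].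
  by apply: (@ball_splitr _ _ (h x)); [exact: By|exact: Bz].
- move=> h k y z Sh Sk /QQ/QN[[A1y _] _] /QQ/QN[[_ A2z] _].
  exact: (A12 (y, z) _ (h, k)).
Qed.

Lemma refining_sequence : exists (s : nat -> stage) (g : nat -> X -> X),
  [/\ maps (s 0%N) id,
      forall n, valid_stage (s n) &
      forall n, refines n (s n) (g n) (s n.+1)].
Proof.
have [next hnext] : exists next : nat * stage -> (X -> X) * stage,
    forall ns, valid_stage ns.2 ->
      valid_stage (next ns).2 /\
      refines ns.1 ns.2 (next ns).1 (next ns).2.
  suff /choice[next hnext] : forall ns : nat * stage,
      exists p : (X -> X) * stage,
      valid_stage ns.2 ->
      valid_stage p.2 /\
      refines ns.1 ns.2 p.1 p.2 by exists next.
  move=> [n s] /=; have [vs|nvs] := pselect (valid_stage s).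
    have [p hp] := refinement n s vs.
    by exists p.
  (* Choice needs a total function; at an invalid stage any pair serves. *)
  by exists (id, s) => /nvs.
pose s := fix s n :=
  if n is m.+1 then (next (m, s m)).2 else Stage [set id] setT setT K.
have vs n : valid_stage (s n).
  elim: n => [|n IH]; last by have [] := hnext (n, s n) IH.
  split => //=; try by split => //; exact: openT.
  - by split=> [|_ ->]; [exact: finite_set1|have [] := hG].
  - exact: openT.
exists s, (fun n => (next (n, s n)).1); split => // n.
by have [] := hnext (n, s n) (vs n).
Qed.

End Embedding.

(** * The limit map on the Cantor space *)

Theorem theorem2p12 (A : realType) (X : completeMetricType A)
    (G : set (X -> X)) (Y : set X) (R : nat -> set (X * X)) (K : set X)
    (hG : homeomorphism_group G)
    (hY : invariant_set G Y)
    (hRmono : {homo R : m n / (m <= n)%N >-> m `<=` n})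
    (hRrefl : forall n, reflexive_rel (R n))
    (hRsym : forall n, symmetric_rel (R n))
    (hRclosed : forall n, closed (R n))
    (hKcompact : compact K)
    (hKpos : ideal_positive (noncovering_open G Y) K)
    (ha : forall (n : nat) (x : X), K x ->
       exists2 g, G g & ~ rel_power (R n) 4 (x, g x))
    (hb : forall g, G g ->
       exists n : nat, forall x, translates G K x -> R n (x, g x)) :
  exists2 x, K x &
    exists phi : cantor_space -> X,
      [/\ continuous phi, injective phi,
          forall c, closure (orbit_of G x) (phi c) &
          rel_pair_hom (E0, ~` E0)
            (orbit_eq G, ~` \bigcup_(n in [set: nat]) R n) phi].
Proof.
have [s [g [s0 vs ref]]] :=
  refining_sequence hG hY hRmono hRsym hRclosed hKcompact hKpos ha hb.
pose O n := outer (s n).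
have mapsword c n : maps (s n) (word g c n).
  elim: n => [//|n IH]; have [[_ ->] _ _ _ _] := ref n.
  by rewrite /=; case: (c n); [right; exists (word g c n)|left].
have Gword c n : G (word g c n) by have [[_ + _ _ _ _]] := vs n; apply.
have wordS c n y : closure (O n.+1) y -> O n ((if c n then g n else id) y).
  by have [_ clO gO _ _] := ref n; case: (c n) => Oy; [exact: gO|exact: clO].
have ball_word c n x y : (word g c n.+1 @` O n.+1) x ->
    (word g c n.+1 @` O n.+1) y -> ball x n.+1%:R^-1%R y.
  have [_ _ _ diam _] := ref n.
  by move=> [x' Ox' <-] [y' Oy' <-]; exact: diam.
have coreO n : core (s n) `<=` O n.
  have [_ _ [_ VO] [CV _] _] := vs n.
  by move=> y /CV Vy; apply: VO; exact: subset_closure.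
have core0 n : core (s n) !=set0.
  have [_ _ _ _ [_]] := vs n; apply: contra_notP => /set0P/negP/negPn/eqP ->.
  move=> U UU; exists set0; split => //; first exact: open0.
  by rewrite set0U.
have [phi phiP] : exists phi : cantor_space -> X,
    forall c n, (word g c n @` O n) (phi c).
  suff /choice[phi phiP] : forall c : cantor_space, exists x,
      forall n, (word g c n @` O n) x by exists phi.
  move=> c; apply: nested_sets_meet => n; last exact: ball_word.
    have [y Cy] := core0 n; exists (word g c n y); exists y => //.
    exact: coreO.
  have cl : closed (word g c n.+1 @` closure (O n.+1)).
    by apply: (group_image_closed hG) => //; exact: closed_closure.
  apply: (@subset_trans _ (word g c n.+1 @` closure (O n.+1))).
    rewrite [X in _ `<=` X](iffLR (closure_id _) cl); apply: closureS.
    by apply: image_subset; exact: subset_closure.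
  move=> _ [y Oy <-] /=; exists ((if c n then g n else id) y) => //.
  exact: wordS.
have phi_unique c N x : (forall n, (N <= n)%N -> (word g c n @` O n) x) ->
    x = phi c.
  move=> Wx; apply: (eq_small_balls N) => n Nn.
  by apply: (ball_word c) => //; apply: Wx; exact: leqW.
(* The prefixes of [c] and [d] below [n] may differ, since refinement separates all pairs of
   words. *)
have sep c d n : c n <> d n -> ~ R n (phi c, phi d).
  wlog : c d / c n = false => [H cd|cn].
    case cn : (c n); last exact: H.
    have dn : d n = false by apply/negbTE/negP => dn; apply: cd; rewrite cn dn.
    by move=> /hRsym; apply: H => //; exact: nesym.
  rewrite cn => /eqP; case dn : (d n) => // _.
  have [_ _ _ _ sepn] := ref n.
  have [y Oy <-] := phiP c n.+1; have [z Oz <-] := phiP d n.+1.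
  by rewrite /= cn dn; exact: sepn.
pose x := phi (fun=> false).
have word0 n : word g (fun=> false) n = id by elim: n => //= n ->.
have Ox n : O n x.
  by have [y Oy] := phiP (fun=> false) n; rewrite word0 /x => <-.
(* All words of the zero sequence are the identity, so [x] shares the small set [O n.+1] with a
   core, which lies in [K]. *)
have Kx : K x.
  have Kclosed : closed K := compact_closed (@metric_hausdorff _ X) hKcompact.
  rewrite (iffLR (closure_id _) Kclosed) => B /nbhs_ballP[e /= e0 eB].
  have [n ne] := exists_natSinv_lt e0; have [y Cy] := core0 n.+1.
  exists y; split; first by have [_ _ _ [_ CK] _] := vs n.+1; exact: CK.
  apply: eB; apply: (le_ball (ltW ne)); apply: (ball_word (fun=> false)).
    by rewrite word0; exists x.
  by rewrite word0; exists y => //; exact: coreO.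
exists x => //; exists phi; split.
- move=> c B /nbhs_ballP[e /= e0 eB]; have [n ne] := exists_natSinv_lt e0.
  apply: filterS (nbhs_cantor_prefix c n.+1) => d cd.
  apply: eB; apply: (le_ball (ltW ne)); apply: (ball_word c) => //.
  by rewrite -(eq_word g d).
- move=> c d cd; apply/funext => n; apply: contrapT => /sep; apply.
  by rewrite cd; exact: hRrefl.
- move=> c B /nbhs_ballP[e /= e0 eB]; have [n ne] := exists_natSinv_lt e0.
  exists (word g c n.+1 x); split; first by exists (word g c n.+1).
  apply: eB; apply: (le_ball (ltW ne)); apply: (ball_word c) => //.
  by exists x.
- split=> c d /=.
    move=> [n cd].
    have [h [Gh hw _]] := group_inv hG (Gword c n.+1).
    (* This carries [phi c] into the sets that determine [phi d]; length [n.+1] covers every place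
       where [c] and [d] may differ. *)
    exists (word g d n.+1 \o h); first exact: group_comp.
    apply: (phi_unique d n.+1) => m nm.
    rewrite (word_eventually_eq g c d n.+1 (word g d n.+1 \o h) _ _ m nm)//.
      by have [y Oy <-] := phiP c m; exists y.
    by apply/funext => y /=; rewrite hw.
  (* A difference at some [m > n] would exclude [R m], which contains [R n]. *)
  move=> ncd [n _ Rn]; apply: ncd; exists n => m nm.
  by apply: contrapT => /sep; apply; exact: (hRmono n m (ltnW nm)).
Qed.
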